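(* Let $V$ be a finite set with $\#V=n$, and let $f,g:\mathcal P(V)^k\to[0,+\infty)$, where $g(A_1,\dots,A_k)>0$ for every inclusion chain of nonempty sets. Let $$S(f)=\{F:\ |F(x)|\le f^M_\triangle(|x|)\ \ \forall x\in\mathbb R^n\},\qquad |x|:=(|x_1|,\dots,|x_n|).$$ Then for every $m=1,\dots,n$, $$\min_{U\subset V,\ \#U=m}\ \ \max_{\text{chain }A_1,\dots,A_k\text{ in }U}\frac{f(A_1,\dots,A_k)}{g(A_1,\dots,A_k)}\ \ge\ \sup_{F\in S(f)}\max\{\lambda_m(F),-\lambda'_m(F)\},$$ where $\lambda_m(F)$ (resp. $\lambda_m'(F)$) is the $m$-th min-max (resp. max-min) eigenvalue of the function pair $(F,\ g^M_\triangle(|\cdot|))$.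
   Context: Piecewise multilinear extension: for $h:\mathcal P(V)^k\to\mathbb R$, $$h^M(x^1,\dots,x^k)=\sum_{i_1,\dots,i_k=0}^{n-1}\prod_{s=1}^k\big(x^s_{(i_s+1)}-x^s_{(i_s)}\big)h\big(V^{(i_1)}(x^1),\dots,V^{(i_k)}(x^k)\big),$$ where $x^s_{(1)}\le\dots\le x^s_{(n)}$ is the non-decreasing rearrangement of $x^s\in\mathbb R^n$, $x^s_{(0)}:=0$, $V^{(0)}(x^s):=V$, $V^{(i)}(x^s):=\{j:x^s_j>x^s_{(i)}\}$ for $i\ge1$ (and $h:=0$ if an argument is empty); $h^M_\triangle(x):=h^M(x,\dots,x)$. A chain in $U$ is a tuple of nonempty subsets of $U$ that are totally ordered by inclusion (in some order). The functions $F:\mathbb R^n\to\mathbb R$ in $S(f)$ are understood to be locally Lipschitz, even and $k$-homogeneous ($F(tx)=t^kF(x)$ for $t>0$). With $G(x)=g^M_\triangle(|x|)$, $$\lambda_m(F)=\inf_{\mathrm{genus}(A)\ge m}\ \sup_{x\in A}\frac{F(x)}{G(x)},\qquad \lambda'_m(F)=\sup_{\mathrm{genus}(A)\ge m}\ \inf_{x\in A}\frac{F(x)}{G(x)},$$ $A$ ranging over compact symmetric subsets of $\mathbb R^n\setminus\{0\}$; the genus of a nonempty symmetric set is the least $s\ge1$ such that it admits an odd continuous map to $\mathbb S^{s-1}$. *)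

(* Defs.v *)
From HB Require Import structures.
From mathcomp Require Import all_boot all_order all_algebra.
From mathcomp Require Import all_classical all_reals all_analysis.

Set Implicit Arguments.
Unset Strict Implicit.
Unset Printing Implicit Defensive.

Import Order.TTheory GRing.Theory Num.Theory.
Import numFieldNormedType.Exports.

Local Open Scope classical_set_scope.
Local Open Scope ring_scope.

Section MultilinearExtension.
Context {R : realType} {V : finType}.

(* R^n with n = #|V| is 'rV[R]_#|V|; its coordinates are labelled by the points
   of V through the enumeration of V. *)
Definition coord_at (x : 'rV[R]_#|V|) (j : V) : R := x ord0 (enum_rank j).

(* x_(i): the entry 0 put in front of the sorted coordinates is x_(0). *)
Definition order_stat (x : 'rV[R]_#|V|) (i : nat) : R :=
  nth 0 (0 :: sort <=%R [seq coord_at x j | j : V]) i.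

Definition level_set (x : 'rV[R]_#|V|) (i : nat) : {set V} :=
  if i == 0%N then finset.setT
  else [set j | order_stat x i < coord_at x j]%SET.

Definition extend0 {k : nat} (h : {ffun 'I_k -> {set V}} -> R)
    (A : {ffun 'I_k -> {set V}}) : R :=
  if [exists s, A s == finset.set0] then 0 else h A.

Definition mlext {k : nat} (h : {ffun 'I_k -> {set V}} -> R)
    (x : 'I_k -> 'rV[R]_#|V|) : R :=
  \sum_(i : {ffun 'I_k -> 'I_#|V|})
    (\prod_(s < k) (order_stat (x s) (i s).+1 - order_stat (x s) (i s))) *
    extend0 h [ffun s => level_set (x s) (i s)].

Definition mlext_diag {k : nat} (h : {ffun 'I_k -> {set V}} -> R)
    (x : 'rV[R]_#|V|) : R := mlext h (fun=> x).

Definition abs_vec (x : 'rV[R]_#|V|) : 'rV[R]_#|V| := map_mx Num.norm x.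

Definition chain_in {k : nat} (U : {set V}) (A : {ffun 'I_k -> {set V}}) : bool :=
  [forall s, (A s != finset.set0) && (A s \subset U)] &&
  [forall s, forall t, (A s \subset A t) || (A t \subset A s)].

End MultilinearExtension.

Section MinMax.
Context {R : realType}.

Definition locally_lipschitz {n : nat} (F : 'rV[R]_n -> R) : Prop :=
  forall x : 'rV[R]_n, exists2 U : set 'rV[R]_n, nbhs x U & [lipschitz F y | y in U].

Definition sym_set {n : nat} (A : set 'rV[R]_n) : Prop :=
  forall x, A x -> A (- x).

(* S^{s-1}; the norm of 'rV[R]_s in the library is the sup norm, so the
   Euclidean one is written out. *)
Definition unit_sphere (s : nat) : set 'rV[R]_s :=
  [set y | \sum_(i < s) y ord0 i ^+ 2 = 1].

Definition odd_sphere_map {n : nat} (A : set 'rV[R]_n) (s : nat) : Prop :=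
  exists phi : 'rV[R]_n -> 'rV[R]_s,
    [/\ {within A, continuous phi},
        forall x, A x -> phi (- x) = - phi x &
        forall x, A x -> unit_sphere (phi x)].

(* An infimum of natural numbers in the extended reals: it is the least such s,
   and +oo if there is none. The empty set has genus 0. *)
Definition genus {n : nat} (A : set 'rV[R]_n) : \bar R :=
  if `[< A = set0 >] then 0%E
  else ereal_inf [set s%:R%:E | s in [set s | (1 <= s)%N /\ odd_sphere_map A s]].

Definition genus_family {n : nat} (m : nat) : set (set 'rV[R]_n) :=
  [set A | [/\ compact A, sym_set A, ~ A 0 & (m%:R%:E <= genus A)%E]].

Definition minmax_eig {n : nat} (F G : 'rV[R]_n -> R) (m : nat) : \bar R :=
  ereal_inf [set ereal_sup [set (F x / G x)%:E | x in A] | A in genus_family m].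

Definition maxmin_eig {n : nat} (F G : 'rV[R]_n -> R) (m : nat) : \bar R :=
  ereal_sup [set ereal_inf [set (F x / G x)%:E | x in A] | A in genus_family m].

End MinMax.

Definition dominated_family {R : realType} {V : finType} {k : nat}
    (f : {ffun 'I_k -> {set V}} -> R) : set ('rV[R]_#|V| -> R) :=
  [set F | [/\ locally_lipschitz F,
               forall x, F (- x) = F x,
               forall t x, 0 < t -> F (t *: x) = t ^+ k * F x &
               forall x, `|F x| <= mlext_diag f (abs_vec x)]].

(* Main.v *)
Require Import Defs.
From mathcomp Require Import all_boot all_order all_algebra.
From mathcomp Require Import all_classical all_reals all_analysis.
From mathcomp Require Import zify lra.

(** Fix a set U of m points and let C be the largest ratio f / g over the
    chains in U.  If x is supported in U, every term of the sum defining
    f^M(|x|) that has a non-zero weight is indexed by a tuple of level sets of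
    |x|, and such a tuple is a chain in U.  The weights being nonnegative and
    the same for f and g, f^M(|x|) <= C g^M(|x|) term by term
    ([mlext_diag_le]); hence |F / G| <= C on the l1 unit sphere of R^U for every
    F in S(f).  Both eigenvalues are therefore bounded by C as soon as this
    sphere competes in their definition, that is, as soon as its genus is at
    least m.

    This last point is the Borsuk-Ulam theorem ([borsuk_ulam]), and it carries
    the bulk of the work.  It is obtained from Ky Fan's parity argument,
    phrased with cochains modulo 2.  Let phi be an odd map from the l1 sphere
    of R^m to the unit sphere of R^l, and label a point x by (i, sign phi_i(x))
    with i chosen so that phi_i(x) is not small.  Antipodal points have opposite
    labels and close points do not.  Let P(s) say that the labels of a simplex
    s, sorted by index, have alternating signs, starting with a prescribed
    sign, and let Q(s) be the same condition with the other starting sign.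
    Deleting the first or the last entry of an alternating sequence leaves an
    alternating one, and every other contribution cancels in pairs, so that the
    coboundary of P is P + Q ([cobd_fan]); moreover Q(s) = P(- s).

    The l1 sphere of R^(d+1) is triangulated by the cross-polytope, which
    consists of a hemisphere and of its antipode, and the boundary of the
    hemisphere is the cross-polytope of R^d.  Summing P + Q over the hemisphere
    therefore shows that the numbers of simplices satisfying P in the two
    cross-polytopes, of R^d and of R^(d+1), have the same parity; for d = 0 only
    the empty simplex is counted, hence both are odd ([fan_odd]).  Barycentric subdivision commutes with the
    boundary and with the antipode ([cobd_subdiv], [subdiv_map]), so the same
    holds after any number of subdivisions, when the simplices are as small as
    uniform continuity of phi requires.  So some simplex with m vertices has
    alternating labels; these have m distinct indices among l, and m <= l. *)

Set Implicit Arguments.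
Unset Strict Implicit.
Unset Printing Implicit Defensive.

Import Order.TTheory GRing.Theory Num.Theory.
Import numFieldNormedType.Exports.

Local Open Scope classical_set_scope.
Local Open Scope ring_scope.

(** * Simplicial cochains modulo 2 and subdivision *)

(** A simplex is the sequence of its vertices and a chain modulo 2 is a list of
    simplices; two lists stand for the same chain when every cochain [w] has the
    same sum over them, so chains are only ever compared through [sum2]. *)
Definition sum2 (T : eqType) (w : seq T -> bool) (c : seq (seq T)) : bool :=
  \big[addb/false]_(s <- c) w s.

Lemma sum2_map (T U : eqType) (w : seq U -> bool) (h : seq T -> seq U) c :
  sum2 w (map h c) = sum2 (w \o h) c.
Proof. by rewrite /sum2 big_map. Qed.

Section Cochains.
Context {T : eqType}.
Implicit Types (w : seq T -> bool) (c : seq (seq T)) (s : seq T).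

Fixpoint facets s : seq (seq T) :=
  if s is x :: s' then s' :: [seq x :: t | t <- facets s'] else [::].

(** Since [[::]] is a facet of [[:: x]] while [[::]] has no facet, the complex is
    the augmented one: its dimension -1 is spanned by the empty simplex. *)
Definition cobd w s : bool := sum2 w (facets s).

Lemma sum2_cons w s c : sum2 w (s :: c) = w s (+) sum2 w c.
Proof. by rewrite /sum2 big_cons. Qed.

Lemma sum2_cat w c1 c2 : sum2 w (c1 ++ c2) = sum2 w c1 (+) sum2 w c2.
Proof. by rewrite /sum2 big_cat. Qed.

Lemma sum2_flatten_map w (h : seq T -> seq (seq T)) c :
  sum2 w (flatten (map h c)) = sum2 (sum2 w \o h) c.
Proof. by rewrite /sum2 big_flatten big_map. Qed.

Lemma sum2_addb w1 w2 c :
  sum2 (fun s => w1 s (+) w2 s) c = sum2 w1 c (+) sum2 w2 c.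
Proof. by rewrite /sum2 big_split. Qed.

Lemma eq_sum2 w1 w2 c : w1 =1 w2 -> sum2 w1 c = sum2 w2 c.
Proof. by move=> eqw; apply: eq_bigr. Qed.

Lemma eq_in_sum2 w1 w2 c : {in c, w1 =1 w2} -> sum2 w1 c = sum2 w2 c.
Proof. by move=> eqw; apply: eq_big_seq. Qed.

Lemma sum2_facets_cons w x s :
  sum2 w (facets (x :: s)) = w s (+) sum2 (w \o cons x) (facets s).
Proof. by rewrite /= sum2_cons sum2_map. Qed.

Lemma size_facets s t : t \in facets s -> size s = (size t).+1.
Proof.
elim: s t => [|x s IH] t //=.
by rewrite inE => /predU1P[-> //|/mapP[u /IH -> ->]].
Qed.

Lemma facets_subseq s t : t \in facets s -> subseq t s.
Proof.
elim: s t => [|x s IH] t //.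
rewrite /= inE => /predU1P[->|/mapP[u /IH us ->]]; first exact: subseq_cons.
by rewrite /= eqxx.
Qed.

(** Write a simplex as a cone over its base: each facet of the base shows up
    once as a face of the base and once inside a lateral facet, and the
    remaining terms are the same sum for the base. *)
Lemma cobd_cobd w s : cobd (cobd w) s = false.
Proof.
elim: s w => [|x s IH] w; first by rewrite /cobd /sum2 big_nil.
rewrite {1}/cobd sum2_facets_cons.
under eq_sum2 => t do rewrite /= /cobd sum2_facets_cons.
by rewrite sum2_addb [X in _ (+) (_ (+) X)]IH /cobd addbF addbb.
Qed.

End Cochains.

Lemma facets_map (T U : eqType) (h : T -> U) (s : seq T) :
  facets (map h s) = map (map h) (facets s).
Proof. by elim: s => //= x s ->; rewrite -!map_comp. Qed.

Section Subdivision.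
Context {T : eqType} (apex : seq T -> T).
Implicit Types (w : seq T -> bool) (s : seq T).

(** The cone, with vertex [apex s], over the subdivided facets of [s].  The
    first argument bounds the recursion, the facets of [s] not being subterms of
    [s].  The cone vertex is a parameter because subdivision is a chain map
    whichever vertices are chosen. *)
Fixpoint subdiv_rec d s : seq (seq T) :=
  if d is d'.+1 then
    if s is [::] then [:: [::]]
    else [seq apex s :: t | t <- flatten [seq subdiv_rec d' u | u <- facets s]]
  else [:: s].

Definition subdiv s := subdiv_rec (size s) s.

Lemma subdiv_nil : subdiv [::] = [:: [::]]. Proof. by []. Qed.

Lemma subdivE s : s != [::] ->
  subdiv s = [seq apex s :: t | t <- flatten [seq subdiv u | u <- facets s]].
Proof.
case: s => // x s _.
rewrite -[LHS]/[seq apex (x :: s) :: t |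
  t <- flatten [seq subdiv_rec (size s) u | u <- facets (x :: s)]].
congr (map _ (flatten _)); apply/eq_in_map => u /size_facets /=.
by case=> ->.
Qed.

(** Subdivision is a chain map.  The boundary of the cone over the subdivided
    boundary of [s] is that subdivided boundary plus the cone over its own
    boundary, and the latter vanishes because, by induction on the dimension,
    subdivision commutes with the boundary on the facets. *)
Lemma cobd_subdiv w s :
  cobd (sum2 w \o subdiv) s = sum2 (cobd w) (subdiv s).
Proof.
have [n] := ubnP (size s); elim: n s w => // n IH [|x s] w ltn.
  by rewrite subdiv_nil /cobd /sum2 !big_nil big_seq1 big_nil.
rewrite [in RHS]subdivE // sum2_map sum2_flatten_map -/(cobd _ _).
set b := apex _.
under [RHS]eq_sum2 => u.
  rewrite /comp; under eq_sum2 => t do rewrite /cobd sum2_facets_cons.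
  rewrite sum2_addb; over.
rewrite sum2_addb -[sum2 _ _]/(cobd _ _).
rewrite (eq_in_sum2 (w2 := cobd (sum2 (w \o cons b) \o subdiv))); last first.
  move=> u /size_facets usz; rewrite IH //.
  by move: ltn; rewrite usz ltnS.
by rewrite -/(cobd _ _) cobd_cobd addbF.
Qed.

Fixpoint iter_subdiv r s : seq (seq T) :=
  if r is r'.+1 then flatten [seq subdiv t | t <- iter_subdiv r' s] else [:: s].

Lemma cobd_iter_subdiv r w s :
  cobd (sum2 w \o iter_subdiv r) s = sum2 (cobd w) (iter_subdiv r s).
Proof.
elim: r w => [|r IH] w /=.
  rewrite [RHS]/sum2 big_seq1 /cobd; apply: eq_sum2 => t /=.
  by rewrite /sum2 big_seq1.
rewrite sum2_flatten_map -[RHS](@eq_sum2 _ (cobd (sum2 w \o subdiv))); last first.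
  by move=> t; rewrite cobd_subdiv.
rewrite -IH /cobd; apply: eq_sum2 => t /=.
by rewrite sum2_flatten_map.
Qed.

Lemma iter_subdiv_nil r : iter_subdiv r [::] = [:: [::]].
Proof. by elim: r => //= r ->. Qed.

Lemma subdiv_size s t : t \in subdiv s -> size t = size s.
Proof.
have [n] := ubnP (size s); elim: n s t => // n IH [|x s] t ltn.
  by rewrite subdiv_nil inE => /eqP ->.
rewrite subdivE // => /mapP[u /flatten_mapP[v vs uv] ->].
have := size_facets vs => -[svE].
by rewrite /= (IH v) // ?svE // -svE.
Qed.

Lemma iter_subdiv_size r s t : t \in iter_subdiv r s -> size t = size s.
Proof.
elim: r t => [|r IH] t /=; first by rewrite inE => /eqP ->.
by move=> /flatten_mapP[u /IH <- /subdiv_size].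
Qed.

Lemma subdiv_map (h : T -> T) s :
  (forall u, apex (map h u) = h (apex u)) ->
  subdiv (map h s) = map (map h) (subdiv s).
Proof.
move=> happ; have [n] := ubnP (size s); elim: n s => // n IH [|x s] ltn.
  by rewrite subdiv_nil.
rewrite !subdivE // happ facets_map.
set F := facets _.
have -> : flatten [seq subdiv u | u <- map (map h) F]
        = map (map h) (flatten [seq subdiv u | u <- F]).
  rewrite map_flatten -!map_comp; congr flatten.
  apply/eq_in_map => u /size_facets usz /=.
  by rewrite IH //; move: ltn; rewrite usz ltnS.
by rewrite -!map_comp.
Qed.

Lemma iter_subdiv_map (h : T -> T) r s :
  (forall u, apex (map h u) = h (apex u)) ->
  iter_subdiv r (map h s) = map (map h) (iter_subdiv r s).
Proof.
move=> happ; elim: r => //= r ->.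
rewrite map_flatten -!map_comp; congr flatten; apply: eq_map => u /=.
exact: subdiv_map.
Qed.

End Subdivision.

(** * Alternating labels and Ky Fan's parity theorem *)

Fixpoint alternating (b : bool) (s : seq bool) : bool :=
  if s is c :: s' then (c == b) && alternating (~~ b) s' else true.

(** Peeling off the first sign [c] gives the induction: for [c = b] the two
    contributions [alternating b s] coming from the first facet and from the
    others cancel. *)
Lemma cobd_alternating b s :
  cobd (alternating b) s = alternating b s (+) alternating (~~ b) s.
Proof.
elim: s b => [|c s IH] b; first by rewrite /cobd /sum2 big_nil.
rewrite /cobd sum2_facets_cons /comp /=.
have [->|cNb] /= := eqVneq c b.
  rewrite -[sum2 _ _]/(cobd (alternating (~~ b)) s) IH negbK addbC -addbA addbb.
  by case: b.
rewrite [sum2 _ _]big1 // negbK addbF.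
by move: cNb; case: c; case: b.
Qed.

Lemma alternating_negb b s :
  alternating b (map negb s) = alternating (~~ b) s.
Proof. by elim: s b => //= c s IH b; rewrite IH; case: c b => -[]. Qed.

(** The label (i, sign) is encoded as the number [2 i + sign]: [flip] changes the
    sign, and sorting labels by [leq] sorts them by index first. *)
Definition flip (a : nat) : nat := if odd a then a.-1 else a.+1.

Lemma odd_flip a : odd (flip a) = ~~ odd a.
Proof. by rewrite /flip; case: ifP => odda; lia. Qed.

(** No edge of the simplex carries opposite labels. *)
Definition flip_free (L : seq nat) := {in L &, forall a c, c != flip a}.

Lemma sort_flip (L : seq nat) : flip_free L ->
  sort leq (map flip L) = map flip (sort leq L).
Proof.
move=> Lff; apply: (sorted_eq leq_trans anti_leq).
- exact: sort_sorted leq_total _.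
- apply: (@homo_sorted_in _ _ (mem L) flip leq leq); first last.
  + exact: sort_sorted leq_total _.
  + by apply/allP => a; rewrite mem_sort.
  + move=> a c aL cL leac; have := Lff a c aL cL.
    by rewrite /flip; case: ifP; case: ifP => ? ?; lia.
- by rewrite perm_sort perm_map // perm_sym perm_sort.
Qed.

(** Two consecutive labels of opposite signs cannot have the same index, for
    they would be opposite labels. *)
Lemma alternating_sorted_half b (L : seq nat) :
  sorted leq L -> flip_free L -> alternating b (map odd L) ->
  sorted ltn (map half L).
Proof.
elim: L b => [|a [|c L] IH] b //= /andP[leac pL] Lff /andP[/eqP odda altc].
apply/andP; split; last first.
  apply: (IH (~~ b)) => //.
  by move=> x y xL yL; apply: Lff; rewrite inE ?xL ?yL orbT.
case/andP: altc => /eqP oddc _.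
have /(_ a c) := Lff; rewrite !inE !eqxx orbT => /(_ isT isT).
by rewrite /flip /=; case: ifP => oa; lia.
Qed.

Section DeletedSums.
Implicit Types (w : seq nat -> bool) (L : seq nat).

(** For a symmetric cochain the sum over facets only depends on the multiset of
    vertices; this is what allows to sort the labels before taking facets. *)
Lemma cobd_rem w L :
  (forall L1 L2, perm_eq L1 L2 -> w L1 = w L2) ->
  cobd w L = \big[addb/false]_(a <- L) w (rem a L).
Proof.
elim: L w => [|a L IH] w w_perm; first by rewrite /cobd /sum2 !big_nil.
rewrite /cobd sum2_facets_cons big_cons /= eqxx; congr (_ (+) _).
rewrite -[LHS]/(cobd _ _) IH; last first.
  by move=> L1 L2 eqL; apply: w_perm; rewrite perm_cons.
apply: eq_big_seq => c cL /=; case: eqVneq => [->|//].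
by apply: w_perm; rewrite perm_sym perm_to_rem.
Qed.

Lemma cobd_perm w L1 L2 :
  (forall L L', perm_eq L L' -> w L = w L') ->
  perm_eq L1 L2 -> cobd w L1 = cobd w L2.
Proof.
move=> w_perm eqL; rewrite !cobd_rem // (perm_big _ eqL) /=.
apply: eq_big_seq => a aL2; apply: w_perm; rewrite -(perm_cons a).
apply: perm_trans (perm_to_rem aL2); apply: perm_trans (eqL).
by rewrite perm_sym perm_to_rem // (perm_mem eqL).
Qed.

End DeletedSums.

Section Fan.
Context {T : eqType} (lab : T -> nat).

(** Sorting makes this cochain symmetric in the vertices: the order in which a
    subdivision lists them is unrelated to their labels. *)
Definition fan b (s : seq T) : bool :=
  alternating b (map odd (sort leq (map lab s))).

(** The facets of the sorted labels are sorted, being subsequences, so that the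
    identity reduces to [cobd_alternating]. *)
Lemma cobd_fan b s : cobd (fan b) s = fan b s (+) fan (~~ b) s.
Proof.
pose w L := alternating b (map odd (sort leq L)).
have w_perm L1 L2 : perm_eq L1 L2 -> w L1 = w L2.
  by move=> /(perm_sortP leq_total leq_trans anti_leq); rewrite /w => ->.
have -> : cobd (fan b) s = cobd w (map lab s).
  by rewrite /cobd facets_map sum2_map.
rewrite (cobd_perm (L2 := sort leq (map lab s))) //; last first.
  by rewrite perm_sym perm_sort.
rewrite /fan -cobd_alternating /cobd facets_map sum2_map.
apply: eq_in_sum2 => L /facets_subseq subL /=.
rewrite /w sorted_sort //; first exact: leq_trans.
by apply: subseq_sorted subL _; [exact: leq_trans | exact: sort_sorted leq_total _].
Qed.

Lemma fan_neg (neg : T -> T) b s :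
  {in s, forall x, lab (neg x) = flip (lab x)} -> flip_free (map lab s) ->
  fan b (map neg s) = fan (~~ b) s.
Proof.
move=> negs ffs; rewrite /fan -map_comp.
have -> : map (lab \o neg) s = map flip (map lab s).
  by rewrite -map_comp; apply/eq_in_map.
rewrite sort_flip // -alternating_negb -!map_comp; congr alternating.
by apply: eq_map => a /=; rewrite odd_flip.
Qed.

Lemma fan_size b s l :
  flip_free (map lab s) -> {in s, forall x, (lab x < l.*2)%N} ->
  fan b s -> (size s <= l)%N.
Proof.
move=> ffs labl /alternating_sorted_half altS.
have {altS} : sorted ltn (map half (sort leq (map lab s))).
  apply: altS; first exact: sort_sorted leq_total _.
  by move=> a c; rewrite !mem_sort; apply: ffs.
move/(sorted_uniq ltn_trans ltnn) => uniqh.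
have := uniq_leq_size (s2 := iota 0 l) uniqh.
rewrite size_map size_sort size_map size_iota; apply => a /mapP[c].
rewrite mem_sort => /mapP[x /labl labx ->] ->.
by rewrite mem_iota /=; lia.
Qed.

End Fan.

Section CrossPolytope.
Context {T : eqType} (neg : T -> T) (negK : involutive neg) (e : nat -> T).
Implicit Types (w : seq T -> bool).

(** The maximal simplices of the boundary of the cross-polytope with vertices
    [e 0, .., e d.-1] and their antipodes: a two-point suspension at each step. *)
Fixpoint cross d : seq (seq T) :=
  if d is d'.+1 then
    [seq e d' :: s | s <- cross d'] ++ [seq neg (e d') :: s | s <- cross d']
  else [:: [::]].

Lemma sum2_crossS w d :
  sum2 w (cross d.+1) =
  sum2 (fun s => w (e d :: s) (+) w (neg (e d) :: s)) (cross d).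
Proof. by rewrite /= sum2_cat !sum2_map sum2_addb. Qed.

Lemma cross_neg w d : sum2 (w \o map neg) (cross d) = sum2 w (cross d).
Proof.
elim: d w => [|d IH] w; first by rewrite /sum2 !big_seq1.
rewrite !sum2_crossS -[RHS]IH; apply: eq_sum2 => s /=.
by rewrite negK addbC.
Qed.

(** In a suspension the two copies of the base cancel, and the other facets are
    suspensions of the facets of the base. *)
Lemma cross_cycle w d : sum2 (cobd w) (cross d) = false.
Proof.
elim: d w => [|d IH] w; first by rewrite /sum2 big_seq1 /cobd /sum2 big_nil.
rewrite sum2_crossS.
under eq_sum2 => s do
  rewrite /cobd !sum2_facets_cons addbACA addbb addFb.
by rewrite sum2_addb !IH.
Qed.

(** Ky Fan's theorem.  The cones [e m :: s] over [cross m] form a hemisphere of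
    [cross m.+1], and the other hemisphere is its antipode; so the sum over
    [cross m.+1] is the sum over one hemisphere of the coboundary, that is, the
    sum over [cross m] since [cross m] is a cycle. *)
Theorem fan_odd (apex : seq T -> T) (lab : T -> nat) r m :
  (forall s, apex (map neg s) = neg (apex s)) ->
  (forall d s t, (d <= m)%N -> s \in cross d -> t \in iter_subdiv apex r s ->
     {in t, forall x, lab (neg x) = flip (lab x)} /\ flip_free (map lab t)) ->
  sum2 (sum2 (fan lab true) \o iter_subdiv apex r) (cross m).
Proof.
move=> negapex; elim: m => [|m IH] admissible.
  by rewrite /sum2 big_seq1 /= iter_subdiv_nil big_seq1.
have {}IH : sum2 (sum2 (fan lab true) \o iter_subdiv apex r) (cross m).
  by apply: IH => d s t dm; apply: admissible; apply: leq_trans dm _.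
set W := sum2 _ \o _ in IH *.
(* The simplices containing the antipode of [e m] are the antipodes of the cones
   [e m :: s], because [cross m] is symmetric. *)
rewrite sum2_crossS sum2_addb.
rewrite -[X in _ (+) X]cross_neg -sum2_addb.
suff -> : sum2 (fun s => W (e m :: s) (+)
                         ((fun s => W (neg (e m) :: s)) \o map neg) s) (cross m)
        = sum2 (fun s => cobd W (e m :: s)) (cross m).
  under eq_sum2 => s do rewrite /cobd sum2_facets_cons.
  by rewrite sum2_addb IH cross_cycle.
apply: eq_in_sum2 => s sm.
rewrite cobd_iter_subdiv (eq_sum2 _ (cobd_fan lab true)) sum2_addb.
congr (_ (+) _).
rewrite -[LHS]/(sum2 _ (iter_subdiv apex r (map neg (e m :: s)))).
rewrite iter_subdiv_map // sum2_map; apply: eq_in_sum2 => t ts /=.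
have [] := admissible m.+1 (e m :: s) t (leqnn _) _ ts.
  by rewrite mem_cat map_f.
exact: fan_neg.
Qed.

End CrossPolytope.

(** * Barycentric subdivision in normed spaces *)

Section Barycenter.
Context {R : realType} {E : normedModType R}.
Implicit Types (s t : seq E) (P : E -> Prop).

Definition barycenter s : E := (size s)%:R^-1 *: \sum_(x <- s) x.

Lemma barycenter_opp s : barycenter (map -%R s) = - barycenter s.
Proof. by rewrite /barycenter size_map big_map sumrN scalerN. Qed.

(** A weak form of convexity that suffices to locate the vertices of a
    subdivision. *)
Definition barycenter_closed P :=
  forall s, s != [::] -> {in s, forall x, P x} -> P (barycenter s).

Lemma subdiv_closed P s t : barycenter_closed P ->
  {in s, forall x, P x} -> t \in subdiv barycenter s -> {in t, forall x, P x}.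
Proof.
move=> Pbar; have [n] := ubnP (size s).
elim: n s t => // n IH [|x s] t ltn Ps.
  by rewrite subdiv_nil inE => /eqP ->.
rewrite subdivE // => /mapP[u /flatten_mapP[v vs uv] -> y].
rewrite inE => /predU1P[->|]; first exact: Pbar.
apply: (IH v) uv y; first by have := size_facets vs; move: ltn => /=; lia.
by move=> z /(mem_subseq (facets_subseq vs)); apply: Ps.
Qed.

Lemma iter_subdiv_closed P r s t : barycenter_closed P ->
  {in s, forall x, P x} -> t \in iter_subdiv barycenter r s ->
  {in t, forall x, P x}.
Proof.
move=> Pbar Ps; elim: r t => [|r IH] t /=; first by rewrite inE => /eqP ->.
by move=> /flatten_mapP[u /IH Pu /subdiv_closed]; apply.
Qed.

Lemma barycenterB s z : s != [::] ->
  barycenter s - z = (size s)%:R^-1 *: \sum_(x <- s) (x - z).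
Proof.
move=> s0; rewrite sumrB scalerBr; congr (_ - _).
rewrite big_const_seq count_predT iter_addr_0 -[z *+ _]scaler_nat scalerA.
by rewrite mulVf ?scale1r // pnatr_eq0 size_eq0.
Qed.

Lemma ball_barycenter_closed z rho : barycenter_closed (fun x => `|x - z| <= rho).
Proof.
move=> s s0 sz; rewrite barycenterB // normrZ ger0_norm ?invr_ge0 //.
rewrite ler_pdivrMl ?ltr0n ?lt0n ?size_eq0 //.
apply: le_trans (ler_norm_sum _ _ _) _.
rewrite big_seq; apply: le_trans (ler_sum _ sz) _.
rewrite -big_seq big_const_seq count_predT iter_addr_0.
by rewrite mulr_natl.
Qed.

Definition diam_le rho s := {in s &, forall x y, `|x - y| <= rho}.

(** The vertex [x] itself contributes 0 to the average of the distances to [x]: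
    this is where the factor [1 - 1 / size s] comes from. *)
Lemma barycenter_dist rho s x : diam_le rho s -> x \in s ->
  `|barycenter s - x| <= (1 - (size s)%:R^-1) * rho.
Proof.
move=> srho xs; have s0 : s != [::] by case: (s) xs.
have sz0 : 0 < (size s)%:R :> R by rewrite ltr0n lt0n size_eq0.
rewrite barycenterB // normrZ ger0_norm ?invr_ge0 //.
rewrite ler_pdivrMl // mulrA mulrBr mulfV ?gt_eqF //.
apply: le_trans (ler_norm_sum _ _ _) _.
rewrite (perm_big _ (perm_to_rem xs)) big_cons /= subrr normr0 add0r.
have remrho y : y \in rem x s -> `|y - x| <= rho.
  by move=> /mem_rem ys; apply: srho.
rewrite big_seq; apply: le_trans (ler_sum _ remrho) _.
rewrite -big_seq big_const_seq count_predT iter_addr_0 size_rem //.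
case: (size s) sz0 => [|k _]; first by rewrite ltxx.
by rewrite /= mulr1 -natr1 addrK mulr_natl.
Qed.

(** The dimension is bounded uniformly by [N] so that the contraction factor is
    the same for all faces and can be iterated. *)
Lemma subdiv_diam (N : nat) rho s t : 0 <= rho -> (size s <= N)%N ->
  diam_le rho s -> t \in subdiv barycenter s ->
  diam_le ((1 - N%:R^-1) * rho) t.
Proof.
move=> rho0; have [n] := ubnP (size s).
elim: n s t => // n IH [|x s] t ltn sN srho.
  by rewrite subdiv_nil inE => /eqP ->.
rewrite subdivE // => /mapP[u /flatten_mapP[v vs uv] ->].
have svE := size_facets vs; have vsub := mem_subseq (facets_subseq vs).
have sxN y : y \in x :: s ->
    `|y - barycenter (x :: s)| <= (1 - N%:R^-1) * rho.
  move=> ys; rewrite distrC; apply: le_trans (barycenter_dist srho ys) _.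
  rewrite ler_wpM2r // lerD2l lerN2 lef_pV2 ?posrE ?ltr0n //; last exact: leq_trans sN.
  by rewrite ler_nat.
have hull : {in u, forall y, `|y - barycenter (x :: s)| <= (1 - N%:R^-1) * rho}.
  apply: (subdiv_closed (@ball_barycenter_closed _ _) _ uv).
  by move=> y /vsub /sxN.
have urho : diam_le ((1 - N%:R^-1) * rho) u.
  apply: (IH v) uv; [by rewrite -svE | by apply: ltnW; rewrite -svE |].
  by move=> y z /vsub ys /vsub zs; apply: srho.
move=> y z; rewrite !inE => /predU1P[->|yu] /predU1P[->|zu].
- rewrite subrr normr0; apply: le_trans (sxN x (mem_head _ _)); exact: normr_ge0.
- by rewrite distrC; apply: hull.
- exact: hull.
- exact: urho.
Qed.

Lemma iter_subdiv_diam (N : nat) rho r s t : (0 < N)%N -> 0 <= rho -> (size s <= N)%N ->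
  diam_le rho s -> t \in iter_subdiv barycenter r s ->
  diam_le ((1 - N%:R^-1) ^+ r * rho) t.
Proof.
move=> N0 rho0 sN srho; elim: r t => [|r IH] t /=.
  by rewrite inE => /eqP ->; rewrite expr0 mul1r.
move=> /flatten_mapP[u us tu]; rewrite exprS -mulrA.
have q0 : 0 <= 1 - N%:R^-1 :> R by rewrite subr_ge0 invf_le1 ?ltr0n // ler1n.
apply: subdiv_diam tu; last exact: IH.
  by rewrite mulr_ge0 ?exprn_ge0.
by rewrite (iter_subdiv_size us).
Qed.

Lemma iter_subdiv_small (N : nat) rho delta : (0 < N)%N -> 0 <= rho -> 0 < delta ->
  exists r, forall s t, (size s <= N)%N -> diam_le rho s ->
    t \in iter_subdiv barycenter r s -> {in t &, forall x y, `|x - y| < delta}.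
Proof.
move=> N0 rho0 delta0.
have q0 : 0 <= 1 - N%:R^-1 :> R by rewrite subr_ge0 invf_le1 ?ltr0n // ler1n.
have q1 : `|1 - N%:R^-1 : R| < 1.
  by rewrite ger0_norm // ltrBlDr ltrDl invr_gt0 ltr0n.
have /cvgr0Pnorm_lt/(_ (delta / (rho + 1))) := cvg_expr q1.
have dr0 : 0 < delta / (rho + 1) by rewrite divr_gt0 // ltr_wpDl.
move=> /(_ dr0)[r _ /(_ r (leqnn r))] /=.
rewrite ger0_norm ?exprn_ge0 // ltr_pdivlMr ?ltr_wpDl // => qr.
exists r => s t sN srho ts x y xt yt.
apply: le_lt_trans (iter_subdiv_diam N0 rho0 sN srho ts xt yt) _.
by apply: le_lt_trans qr; rewrite ler_wpM2l ?exprn_ge0 // lerDl.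
Qed.

End Barycenter.

(** Heine-Cantor, relative to a compact set. *)
Lemma compact_within_unif_continuous {R : realType} (E E' : normedModType R)
    (A : set E) (h : E -> E') (eps : R) :
  compact A -> {within A, continuous h} -> 0 < eps ->
  exists2 delta : R, 0 < delta &
    forall x y, A x -> A y -> `|x - y| < delta -> `|h x - h y| < eps.
Proof.
move=> /compact_near_coveringP Acov /subspace_continuousP hc eps0.
pose P (d : R) x := forall y, A x -> A y -> `|x - y| < d -> `|h x - h y| < eps.
have [x Ax|/= d0 [d0p H]] := Acov R (0 : R)^'+ P _ _.
  have /cvgrPdist_lt/(_ (eps / 2)) := hc x Ax.
  rewrite divr_gt0 // => /(_ isT); rewrite near_withinE => /nbhs_ballP[d /= d0 hd].
  exists (ball x (d / 2), [set e | 0 < e] `&` [set e | e < d / 2]) => /=.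
    split; first by apply: nbhsx_ballx; rewrite divr_gt0.
    apply: filterI; first exact: nbhs_right_gt.
    by apply: nbhs_right_lt; rewrite divr_gt0.
  move=> [x' e] /= [xx' [e0 ed]] y Ax' Ay x'y.
  have := hd x'; have := hd y; rewrite -!ball_normE /= in xx' *.
  move=> /(_ _ Ay) hy /(_ _ Ax') hx.
  have {}hx : `|h x - h x'| < eps / 2 by apply: hx; lra.
  have {}hy : `|h x - h y| < eps / 2.
    apply: hy; have := ler_distD x' x y; lra.
  have := ler_distD (h x) (h x') (h y); rewrite (distrC (h x') (h x)); lra.
exists (d0 / 2); first by rewrite divr_gt0.
move=> x y Ax Ay xy; apply: (H (d0 / 2)) => //=.
- by rewrite /ball_ /= sub0r normrN ger0_norm; lra.
- by rewrite divr_gt0.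
Qed.

(** * The Borsuk-Ulam theorem on the l1 sphere *)

Lemma normr_coord_le {R : realType} {n : nat} (x : 'rV[R]_n) i :
  `|x ord0 i| <= `|x|.
Proof.
rewrite [leRHS]/Num.Def.normr /= mx_normrE.
by apply/bigmax_geP; right => /=; exists (ord0, i).
Qed.

Section L1Sphere.
Context {R : realType} {n : nat}.
Implicit Types (J : {set 'I_n}) (x : 'rV[R]_n) (b : 'I_n -> bool).

Definition l1_sphere J : set 'rV[R]_n :=
  [set x | (forall i, i \notin J -> x ord0 i = 0) /\
           \sum_i `|x ord0 i| = 1].

Lemma l1_sphere_norm_le J x : l1_sphere J x -> `|x| <= 1.
Proof.
move=> [_ x1]; rewrite [leLHS]/Num.Def.normr /= mx_normrE.
apply/bigmax_leP; split=> // -[i j] _ /=; rewrite ord1 -x1.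
by rewrite (bigD1 j) //= lerDl sumr_ge0.
Qed.

Lemma l1_sphere_opp J x : l1_sphere J x -> l1_sphere J (- x).
Proof.
move=> [xJ x1]; split=> [i /xJ|]; first by rewrite mxE => ->; rewrite oppr0.
by rewrite -x1; apply: eq_bigr => i _; rewrite mxE normrN.
Qed.

Lemma l1_sphere_neq0 J : ~ l1_sphere J 0.
Proof.
move=> [_]; rewrite big1 => [/esym/eqP|i _]; first by rewrite oner_eq0.
by rewrite mxE normr0.
Qed.

Lemma l1_sphere_compact J : compact (l1_sphere J).
Proof.
apply: bounded_closed_compact.
  exists 1; split=> // M M1 x /l1_sphere_norm_le x1.
  exact: le_trans x1 (ltW M1).
have -> : l1_sphere J =
    (\bigcap_(i in [set i | i \notin J]) (fun x => x ord0 i) @^-1` [set 0])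
    `&` (fun x => \sum_i `|x ord0 i|) @^-1` [set 1].
  by [].
apply: closedI.
  apply: closed_bigI => i _; apply: preimage_closed; last exact: closed_eq.
  by move=> x _; apply: coord_continuous.
apply: preimage_closed; last exact: closed_eq.
move=> x _; apply: continuous_big => [|i _ y]; first exact: add_continuous.
apply: continuous_comp; first exact: coord_continuous.
exact: norm_continuous.
Qed.

(** In the orthant with signs [b] the equation of the l1 sphere is linear, so that
    subdividing a simplex of the cross-polytope creates no vertex off the
    sphere. *)
Definition orthant_face J b : set 'rV[R]_n :=
  [set x | [/\ forall i, i \notin J -> x ord0 i = 0,
               forall i, 0 <= (-1) ^+ b i * x ord0 i &
               \sum_i (-1) ^+ b i * x ord0 i = 1]].

Lemma orthant_face_sub J b : orthant_face J b `<=` l1_sphere J.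
Proof.
move=> x [xJ xb x1]; split=> //; rewrite -x1; apply: eq_bigr => i _.
by rewrite -(ger0_norm (xb i)) normrMsign.
Qed.

Lemma orthant_face_barycenter J b : barycenter_closed (orthant_face J b).
Proof.
move=> s s0 sP; have sz0 : (size s)%:R != 0 :> R by rewrite pnatr_eq0 size_eq0.
have barE i : barycenter s ord0 i = (size s)%:R^-1 * \sum_(x <- s) x ord0 i.
  by rewrite mxE summxE.
split=> [i iJ|i|].
- rewrite barE big_seq big1 ?mulr0 // => x /sP[xJ _ _]; exact: xJ.
- rewrite barE mulrCA mulr_ge0 ?invr_ge0 // mulr_sumr big_seq sumr_ge0 // => x.
  by move=> /sP[].
- under eq_bigr => i _ do rewrite barE mulrCA mulr_sumr.
  rewrite -mulr_sumr exchange_big /= big_seq.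
  under eq_bigr => x /sP[_ _ ->] do [].
  by rewrite -big_seq big_const_seq count_predT iter_addr_0 mulVf.
Qed.

Section Vertices.
Context (J : {set 'I_n}) (j : nat -> 'I_n).
Context (jJ : forall i, (i < #|J|)%N -> j i \in J).
Context (j_inj : {in gtn #|J| &, injective j}).

Definition axis_vec (i : nat) : 'rV[R]_n := delta_mx ord0 (j i).

Lemma signed_axis_vec_face b i : (i < #|J|)%N ->
  orthant_face J b ((-1) ^+ b (j i) *: axis_vec i).
Proof.
move=> /jJ jiJ.
have E k : (-1) ^+ b k * ((-1) ^+ b (j i) *: axis_vec i) ord0 k = (k == j i)%:R.
  rewrite !mxE eqxx /= mulrA; case: eqVneq => [->|_]; last by rewrite mulr0.
  by rewrite -signr_addb addbb mulr1.
split=> [k kJ|k|].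
- rewrite !mxE eqxx /=; case: eqVneq kJ => [->|_ _]; first by rewrite jiJ.
  by rewrite mulr0.
- by rewrite E.
- under eq_bigr => k _ do rewrite E.
  by rewrite (bigD1 (j i)) //= eqxx big1 ?addr0 // => k /negPf ->.
Qed.

(** A simplex of the cross-polytope never contains two antipodal vertices, so
    its signs extend to a choice of orthant. *)
Lemma cross_signed d s : (d <= #|J|)%N -> s \in cross -%R axis_vec d ->
  exists b, forall x, x \in s ->
    exists2 i, (i < d)%N & x = (-1) ^+ b (j i) *: axis_vec i.
Proof.
elim: d s => [|d IH] s dJ; first by rewrite inE => /eqP ->; exists xpred0.
have step (c : bool) u : u \in cross -%R axis_vec d -> exists b, forall x,
    x \in (-1) ^+ c *: axis_vec d :: u ->
    exists2 i, (i < d.+1)%N & x = (-1) ^+ b (j i) *: axis_vec i.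
  move=> /(IH _ (ltnW dJ))[b bu]; exists (fun i => if i == j d then c else b i).
  move=> x; rewrite inE => /predU1P[->|/bu[i id ->]].
    by exists d => //; rewrite eqxx.
  exists i; first exact: ltnW.
  case: eqVneq => // jE.
  have iE : i = d by apply: j_inj jE; rewrite inE //; apply: ltn_trans dJ.
  by rewrite iE ltnn in id.
rewrite mem_cat => /orP[] /mapP[u ud ->].
  by have := step false u ud; rewrite expr0 scale1r.
by have := step true u ud; rewrite expr1 scaleN1r.
Qed.

Lemma cross_face d s : (d <= #|J|)%N -> s \in cross -%R axis_vec d ->
  exists b, {in s, forall x, orthant_face J b x}.
Proof.
move=> dJ /(cross_signed dJ)[b bs]; exists b => x /bs[i id ->].
by apply: signed_axis_vec_face; apply: leq_trans dJ.
Qed.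

Lemma cross_size d s : s \in cross -%R axis_vec d -> size s = d.
Proof.
elim: d s => [|d IH] s; first by rewrite inE => /eqP ->.
by rewrite mem_cat => /orP[] /mapP[u /IH <- ->].
Qed.

End Vertices.

Section CoordinateLabel.
Context (l : nat) (phi : 'rV[R]_n -> 'rV[R]_l).

Let large (x : 'rV[R]_n) (i : 'I_l) : bool := l.+1%:R^-1 <= `|phi x ord0 i|.

(** The threshold [1 / (l + 1)] is small enough for some coordinate of a unit
    vector to reach it, see [unit_sphere_large]; the value 0 is a default which
    is not taken on the sphere. *)
Definition coord_label x : nat :=
  if [pick i | large x i] is Some i then
    (nat_of_bool (phi x ord0 i < 0)%R + (nat_of_ord i).*2)%N else 0%N.

Lemma unit_sphere_large x : unit_sphere (phi x) -> exists i, large x i.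
Proof.
move=> phi1; apply/existsP; apply: contraPT phi1 => /existsPn small.
apply/eqP; rewrite lt_eqF //.
have c0 : 0 < l.+1%:R^-1 :> R by rewrite invr_gt0.
apply: (@le_lt_trans _ _ (\sum_(i < l) l.+1%:R^-1)).
  apply: ler_sum => i _; have := small i; rewrite -ltNge => /ltW smalli.
  rewrite -real_normK ?num_real // expr2.
  apply: le_trans (_ : _ * 1 <= _); last by rewrite mulr1.
  rewrite ler_pM //; apply: le_trans smalli _.
  by rewrite invf_le1 // ler1n.
rewrite sumr_const card_ord -[_ *+ _]mulr_natl ltr_pdivrMr // mul1r ltr_nat.
by [].
Qed.

Lemma coord_labelP x : unit_sphere (phi x) ->
  exists2 i : 'I_l, large x i &
    coord_label x = (nat_of_bool (phi x ord0 i < 0)%R + (nat_of_ord i).*2)%N.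
Proof.
move=> /unit_sphere_large[i xi]; rewrite /coord_label.
by case: pickP => [k xk|/(_ i)]; [exists k | rewrite xi].
Qed.

Lemma coord_label_lt x : unit_sphere (phi x) -> (coord_label x < l.*2)%N.
Proof. by move=> /coord_labelP[i _ ->]; have := ltn_ord i; case: (_ < 0); lia. Qed.

(** The two labels use the same index because [pick] selects it through the
    predicate [large], which takes the same values at [x] and [- x]. *)
Lemma coord_label_opp x : unit_sphere (phi x) -> phi (- x) = - phi x ->
  coord_label (- x) = flip (coord_label x).
Proof.
move=> phi1 phiN; have [k xk] := unit_sphere_large phi1; rewrite /coord_label.
have -> : [pick i | large (- x) i] = [pick i | large x i].
  by apply: eq_pick => i; rewrite /large phiN mxE normrN.
case: pickP => [i|/(_ k)]; last by rewrite xk.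
rewrite /large phiN mxE => large_i.
have : phi x ord0 i != 0.
  by rewrite -normr_gt0; apply: lt_le_trans large_i; rewrite invr_gt0.
rewrite oppr_lt0 /flip oddD odd_double addbF.
by case: ltgtP => //= _ _; lia.
Qed.

(** Opposite labels would put the values of one coordinate at distance at least
    [2 / (l + 1)]. *)
Lemma coord_label_close x y : unit_sphere (phi x) -> unit_sphere (phi y) ->
  `|phi x - phi y| < l.+1%:R^-1 -> coord_label y != flip (coord_label x).
Proof.
move=> /coord_labelP[i xi ->] /coord_labelP[k yk ->] xy.
have c0 : 0 < l.+1%:R^-1 :> R by rewrite invr_gt0.
apply/eqP => E.
have ki : k = i.
  apply/val_inj; move: E; rewrite /flip; case: (_ < 0); case: (_ < 0) => /=;
  by rewrite ?oddD ?odd_double /=; lia.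
move: E yk; rewrite ki => E yk.
have {xy} := le_lt_trans (normr_coord_le _ i) xy.
rewrite !mxE; move: xi yk E; rewrite /large /flip oddD odd_double addbF.
move: (l.+1%:R^-1) (phi x ord0 i) (phi y ord0 i) c0 => c u v c0.
have [u0|u0] := ltP u 0; have [v0|v0] := ltP v 0 => /=; try lia; move=> + + _.
  rewrite (ltr0_norm u0) (ger0_norm v0) => xi yk.
  by rewrite ltr_norml => /andP[]; lra.
rewrite (ger0_norm u0) (ltr0_norm v0) => xi yk.
by rewrite ltr_norml => /andP[]; lra.
Qed.

End CoordinateLabel.

(** If a simplex of a fine subdivision has alternating labels, its [#|J|]
    vertices have distinct indices among the [l] coordinates of the target. *)
Theorem borsuk_ulam J l : odd_sphere_map (l1_sphere J) l -> (#|J| <= l)%N.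
Proof.
case=> phi [phic phiN phi1].
have [->//|J0] := posnP #|J|.
have [i0 i0J] : exists i, i \in J by apply/card_gt0P.
(* The coordinates in J are enumerated; i0 is only a default value. *)
pose j k := nth i0 (enum J) k.
have jJ k : (k < #|J|)%N -> j k \in J.
  by move=> kJ; rewrite -mem_enum mem_nth // -cardE.
have j_inj : {in gtn #|J| &, injective j}.
  move=> k k'; rewrite !inE cardE => kJ k'J /eqP.
  by rewrite nth_uniq ?enum_uniq // => /eqP.
have c0 : 0 < l.+1%:R^-1 :> R by rewrite invr_gt0.
have [delta delta0 phi_close] :=
  compact_within_unif_continuous (@l1_sphere_compact J) phic c0.
have [r small] := iter_subdiv_small (E := 'rV[R]_n) J0 (ler0n _ 2) delta0.
have admissible d s t : (d <= #|J|)%N -> s \in cross -%R (axis_vec j) d ->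
    t \in iter_subdiv barycenter r s ->
  {in t, forall x, coord_label phi (- x) = flip (coord_label phi x)} /\
  [/\ flip_free (map (coord_label phi) t),
      {in t, forall x, (coord_label phi x < l.*2)%N} & size t = d].
  move=> dJ sd ts; have sz := cross_size sd.
  have [b sb] := cross_face jJ j_inj dJ sd.
  have sA x : x \in s -> l1_sphere J x by move=> /sb /orthant_face_sub.
  have tA x : x \in t -> l1_sphere J x.
    move=> xt; apply: (@orthant_face_sub _ b).
    exact: iter_subdiv_closed (@orthant_face_barycenter J b) sb ts x xt.
  have sdiam : diam_le 2 s.
    move=> x y /sA/l1_sphere_norm_le x1 /sA/l1_sphere_norm_le y1.
    by apply: le_trans (ler_normB _ _) _; lra.
  split=> [x /tA Ax|]; first by apply: coord_label_opp; [exact: phi1|exact: phiN].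
  split=> [a c /mapP[x xt ->] /mapP[y yt ->]|x /tA/phi1|].
  - apply: coord_label_close; [exact/phi1/tA|exact/phi1/tA|].
    apply: phi_close; [exact: tA|exact: tA|].
    by apply: small ts x y xt yt; rewrite ?sz.
  - exact: coord_label_lt.
  - by rewrite (iter_subdiv_size ts) sz.
have := fan_odd (@opprK _) (e := axis_vec j) (r := r) (@barycenter_opp _ _)
  (fun d s t dJ sd ts => let: conj labN (And3 ff _ _) := admissible d s t dJ sd ts
                         in conj labN ff).
move=> odd_fan.
have : exists2 s, s \in cross -%R (axis_vec j) #|J| &
       exists2 t, t \in iter_subdiv barycenter r s & fan (coord_label phi) true t.
  apply: contrapT => nofan; move: odd_fan; apply/negP.
  rewrite /sum2 big_seq big1 // => s sJ /=; rewrite /sum2 big_seq big1 // => t ts.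
  by apply/negbTE/negP => ft; apply: nofan; exists s => //; exists t.
case=> s sJ [t ts ft].
have [_ [ff lt <-]] := admissible _ s t (leqnn _) sJ ts.
exact: fan_size ff lt ft.
Qed.

End L1Sphere.

(** * Genus of the l1 sphere, multilinear extensions and eigenvalues *)

Lemma genus_l1_sphere {R : realType} {n : nat} (J : {set 'I_n}) :
  (#|J|%:R%:E <= genus (@l1_sphere R n J))%E.
Proof.
rewrite /genus; case: asboolP => [A0|_].
  have [->//|J0] := posnP #|J|; have [i iJ] := card_gt0P J0.
  have : l1_sphere J ((-1) ^+ false *: delta_mx ord0 i : 'rV[R]_n).
    apply: (orthant_face_sub (b := xpred0)).
    exact: (@signed_axis_vec_face _ _ J (fun=> i) _ xpred0 0).
  by rewrite A0.
apply: le_ereal_inf_tmp => _ /= [s [_ /borsuk_ulam Js] <-].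
by rewrite lee_fin ler_nat.
Qed.

Lemma l1_sphere_family {R : realType} {n : nat} (J : {set 'I_n}) :
  genus_family #|J| (@l1_sphere R n J).
Proof.
split; [exact: l1_sphere_compact | by move=> x; apply: l1_sphere_opp
  | exact: l1_sphere_neq0 | exact: genus_l1_sphere].
Qed.

Section LevelSets.
Context {R : realType} {V : finType} (x : 'rV[R]_#|V|).
Context (x_ge0 : forall v, 0 <= coord_at x v).

Let stats := 0 :: sort <=%R [seq coord_at x v | v : V].

Lemma size_stats : size stats = #|V|.+1.
Proof. by rewrite /= size_sort size_image. Qed.

Lemma sorted_stats : sorted <=%R stats.
Proof.
rewrite /= path_min_sorted ?sort_le_sorted //.
by apply/allP => y; rewrite mem_sort => /mapP[v _ ->].
Qed.

Lemma order_stat_le i j : (i <= j <= #|V|)%N -> order_stat x i <= order_stat x j.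
Proof.
move=> /andP[ij jV]; apply: (sorted_leq_nth le_trans le_refl 0 sorted_stats) => //;
  by rewrite inE size_stats ltnS // (leq_trans ij).
Qed.

Lemma order_stat1_le v : order_stat x 1 <= coord_at x v.
Proof.
have : coord_at x v \in behead stats.
  by rewrite /= mem_sort; apply/map_f; rewrite mem_enum.
move=> /(nthP 0)[i]; rewrite size_behead size_stats /= => iV <-.
by apply: (@order_stat_le 1 i.+1); exact: iV.
Qed.

Lemma level_set_le i j : (i <= j <= #|V|)%N -> level_set x j \subset level_set x i.
Proof.
move=> ij; rewrite /level_set; case: (eqVneq j 0%N) => [j0|_].
  by have -> : i = 0%N by lia.
case: (eqVneq i 0%N) => [_|_]; first exact: finset.subsetT.
by apply/fintype.subsetP => v; rewrite !inE; apply: le_lt_trans (order_stat_le ij).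
Qed.

(** For [i = 0] the level set is the whole of [V], but then a non-zero gap means
    that all entries of [x] are positive, so that [U] is the whole of [V]. *)
Lemma level_set_support (U : {set V}) i :
  (forall v, v \notin U -> coord_at x v = 0) -> (i < #|V|)%N ->
  order_stat x i.+1 - order_stat x i != 0 -> level_set x i \subset U.
Proof.
move=> xU iV gap; apply/fintype.subsetP => v; apply: contraLR => /xU xv.
rewrite /level_set; case: (eqVneq i 0%N) gap => [->|i0 _]; last first.
  by rewrite inE xv -leNgt; apply: (@order_stat_le 0 i); lia.
have := order_stat1_le v; rewrite xv subr0 => x1 /negP[].
by rewrite eq_le x1 (@order_stat_le 0 1) //; lia.
Qed.

(** The comparison can be made term by term: a tuple of level sets with non-zero
    weight is a chain in [U], unless one of them is empty, and then both
    extensions by zero vanish. *)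
Lemma mlext_diag_le k (f g : {ffun 'I_k -> {set V}} -> R) (U : {set V}) C :
  (forall v, v \notin U -> coord_at x v = 0) ->
  (forall A, chain_in U A -> f A <= C * g A) ->
  mlext_diag f x <= C * mlext_diag g x.
Proof.
move=> xU fg; rewrite /mlext_diag /mlext mulr_sumr; apply: ler_sum => i _.
rewrite mulrCA.
have [/eqP/prodf_eq0[s _ /eqP s0]|/prodf_neq0 gaps] :=
    eqVneq (\prod_(s < k) (order_stat x (i s).+1 - order_stat x (i s))) 0.
  by rewrite (bigD1 s) //= s0 !mul0r.
apply: ler_wpM2l.
  apply: prodr_ge0 => s _; rewrite subr_ge0; apply: order_stat_le.
  by rewrite leqnSn ltn_ord.
rewrite /extend0; case: existsP => [_|ne]; first by rewrite mulr0.
apply: fg; apply/andP; split.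
  apply/forallP => s; apply/andP; split.
    by apply/negP => s0; apply: ne; exists s.
  by rewrite ffunE; apply: level_set_support => //; apply: gaps.
apply/forallP => s; apply/forallP => t; rewrite !ffunE.
have [st|ts] := leqP (i s) (i t).
  by rewrite [X in _ || X]level_set_le ?orbT // st ltnW.
by rewrite level_set_le // (ltnW ts) ltnW.
Qed.

Lemma mlext_diag_ge0 k (f : {ffun 'I_k -> {set V}} -> R) :
  (forall A, 0 <= f A) -> 0 <= mlext_diag f x.
Proof.
move=> f0; apply: sumr_ge0 => i _; apply: mulr_ge0.
  apply: prodr_ge0 => s _; rewrite subr_ge0; apply: order_stat_le.
  by rewrite leqnSn ltn_ord.
by rewrite /extend0; case: ifP.
Qed.

End LevelSets.

Lemma eigs_le {R : realType} {n : nat} (F G : 'rV[R]_n -> R) m (S : set 'rV[R]_n) C :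
  genus_family m S -> (forall x, S x -> `|F x / G x| <= C) ->
  (maxe (minmax_eig F G m) (- maxmin_eig F G m) <= C%:E)%E.
Proof.
move=> Sm SC; rewrite ge_max; apply/andP; split.
  apply: le_trans (_ : (ereal_sup [set (F x / G x)%:E | x in S] <= _)%E).
    by apply: ereal_inf_lbound; exists S.
  apply: ge_ereal_sup => _ [x /SC xC <-]; rewrite lee_fin.
  by apply: le_trans xC; apply: ler_norm.
rewrite leeNl.
apply: le_trans (_ : (_ <= ereal_inf [set (F x / G x)%:E | x in S])%E) _; last first.
  by apply: ereal_sup_ubound; exists S.
apply: le_ereal_inf_tmp => _ [x /SC xC <-]; rewrite -EFinN lee_fin lerNl.
by apply: le_trans xC; rewrite -normrN; apply: ler_norm.
Qed.

Lemma chain_const {k} {V : finType} (U : {set V}) :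
  U != finset.set0 -> chain_in U [ffun _ : 'I_k => U].
Proof.
move=> U0; apply/andP; split; apply/forallP => s.
  by rewrite ffunE U0 /=.
by apply/forallP => t; rewrite !ffunE fintype.subxx.
Qed.

Lemma chain_inT {k} {V : finType} (U : {set V}) (A : {ffun 'I_k -> {set V}}) :
  chain_in U A -> chain_in finset.setT A.
Proof.
move=> /andP[/forallP AU Ac]; apply/andP; split=> //.
by apply/forallP => s; rewrite finset.subsetT andbT; case/andP: (AU s).
Qed.

Theorem theorem1p6 (R : realType) (V : finType) (k : nat)
    (f g : {ffun 'I_k -> {set V}} -> R)
    (f_ge0 : forall A, 0 <= f A)
    (g_ge0 : forall A, 0 <= g A)
    (g_gt0 : forall A, chain_in finset.setT A -> 0 < g A)
    (m : nat) (m_gt0 : (1 <= m)%N) (m_le : (m <= #|V|)%N) :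
  let G := fun x : 'rV[R]_#|V| => mlext_diag g (abs_vec x) in
  (ereal_sup [set maxe (minmax_eig F G m) (- maxmin_eig F G m) |
                F in dominated_family f]
   <= \big[mine/+oo]_(U : {set V} | #|U| == m)
        \big[maxe/-oo]_(A : {ffun 'I_k -> {set V}} | chain_in U A)
          (f A / g A)%:E)%E.
Proof.
lazy zeta; set G := fun x : _ => mlext_diag g (abs_vec x).
apply: ge_ereal_sup => _ [F [_ _ _ Ff] <-].
apply/bigmin_geP; split=> [|U /eqP Um]; first exact: leey.
have : forall A : {ffun 'I_k -> {set V}}, chain_in U A -> ((f A / g A)%:E <=
    \big[maxe/-oo]_(A : {ffun 'I_k -> {set V}} | chain_in U A) (f A / g A)%:E)%E.
  by move=> A AU; apply: le_bigmax_cond.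
have U0 : U != finset.set0 by rewrite -finset.card_gt0 Um.
(* The constant tuple U makes the maximum over chains nonnegative, hence not -oo. *)
have AU := chain_const (k := k) U0.
move: (\big[_/_]_(A | _) _) => [C|_|/(_ _ AU)]; [|exact: leey|by rewrite leeNy_eq].
move=> ratioC.
have C0 : 0 <= C.
  by have := ratioC _ AU; rewrite lee_fin; apply: le_trans; apply: divr_ge0.
pose J := (enum_rank @: U)%SET : {set 'I_#|V|}.
have Jm : #|J| = m by rewrite card_imset //; apply: enum_rank_inj.
have Jfam := @l1_sphere_family R _ J; rewrite Jm in Jfam.
apply: (eigs_le Jfam) => x [xJ _].
have ax0 v : 0 <= coord_at (abs_vec x) v by rewrite /coord_at mxE.
have axU v : v \notin U -> coord_at (abs_vec x) v = 0.
  move=> vU; rewrite /coord_at mxE xJ ?normr0 //.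
  by apply: contraNN vU => /imsetP[u uU /enum_rank_inj ->].
have FC : `|F x| <= C * G x.
  apply: le_trans (Ff x) _; apply: mlext_diag_le ax0 _ _ _ _ _ axU _ => A cA.
  by rewrite -ler_pdivrMr ?g_gt0 ?(chain_inT cA) // -lee_fin ratioC.
have G0 : 0 <= G x by apply: mlext_diag_ge0.
(* When G x = 0 the quotient is 0 by convention, and C is nonnegative. *)
have [Gx0|Gx0] := eqVneq (G x) 0; first by rewrite Gx0 invr0 mulr0 normr0.
by rewrite normrM normfV (ger0_norm G0) ler_pdivrMr // lt_def Gx0.
Qed.
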